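(* Let $k$ be a field, $A=k[x,y]$ the polynomial Hopf algebra in two variables and $\mathcal{I}=k(x\otimes y-y\otimes x)\subseteq A\otimes A$. Then there is a one-to-one correspondence between the co-Poisson coalgebra structures $q:A\to A\otimes A$ on $A$ and the linear maps $I:A\to\mathcal{I}$, given by $$q\mapsto\Big(I:A\to\mathcal{I},\ a\mapsto\sum(-1)^{|a_2|}q(a_1)\Delta(a_2)\Big),$$ with inverse map $$I\mapsto\Big(q:A\to A\otimes A,\ a\mapsto\sum I(a_1)\Delta(a_2)\Big).$$
   Context: $A=k[x,y]$ is the Hopf algebra whose comultiplication $\Delta$ is the algebra map with $\Delta(x)=x\otimes1+1\otimes x$, $\Delta(y)=y\otimes1+1\otimes y$. Sweedler notation: $\Delta(a)=\sum a_1\otimes a_2$; for a monic monomial $a$, $|a|$ is its degree, $\Delta(a)$ is expanded in the monomial basis, and expressions with signs $(-1)^{|a_2|}$ are extended linearly to all of $A$. Products are taken in the algebra $A\otimes A$. $t_n:V^{\otimes n}\to V^{\otimes n}$ is $v_1\otimes\cdots\otimes v_n\mapsto v_n\otimes v_1\otimes\cdots\otimes v_{n-1}$. A linear map $q:C\to C\otimes C$ on a coalgebra $(C,\Delta,\varepsilon)$ is a co-Poisson coalgebra structure if $(1+t_2)q=0$, $(1+t_3+t_3^2)(q\otimes1)q=0$, and $(\Delta\otimes1)q=(1\otimes q)\Delta-t_3^2(q\otimes1)\Delta$.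
   Formalization: The field k is assumed to have characteristic 0; in every characteristic p > 0 the claim fails, since q(a) = (x⊗x^p − x^p⊗x)Δ(a) is a co-Poisson structure whose map I has I(1) = x⊗x^p − x^p⊗x, not in 𝓘. *)

(* Defs.v *)
From HB Require Import structures.
From mathcomp Require Import all_boot all_order all_algebra.
From mathcomp.multinomials Require Import ssrcomplements mpoly.

Set Implicit Arguments.
Unset Strict Implicit.
Unset Printing Implicit Defensive.

Import GRing.Theory.
Local Open Scope ring_scope.

(* The tensor product of the polynomial algebras k[X_0..X_(m-1)] and           *)
(* k[X_0..X_(n-1)] is modelled by k[X_0..X_(m+n-1)]: the pure tensor p ⊗ q is  *)
(* the product of p in the first m variables and q in the last n variables.    *)
(* The lemmas below show that (p, q) |-> p ⊗ q is bilinear with the universal  *)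
(* property of the tensor product (tens_liftP, tens_ext), and that the ring    *)
(* structure is the one of the tensor product of algebras (tensM, tens11).     *)

Section Tensor.
Context {k : fieldType}.

Definition tens m n (p : {mpoly k[m]}) (q : {mpoly k[n]}) : {mpoly k[m + n]} :=
  (p \mPo [tuple 'X_(lshift n i) | i < m]) *
  (q \mPo [tuple 'X_(rshift m j) | j < n]).

Notation "p ⊗ q" := (tens p q) (at level 40, left associativity).

Lemma tensDl m n (p p' : {mpoly k[m]}) (q : {mpoly k[n]}) :
  (p + p') ⊗ q = p ⊗ q + p' ⊗ q.
Proof. by rewrite /tens comp_mpolyD mulrDl. Qed.

Lemma tensDr m n (p : {mpoly k[m]}) (q q' : {mpoly k[n]}) :
  p ⊗ (q + q') = p ⊗ q + p ⊗ q'.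
Proof. by rewrite /tens comp_mpolyD mulrDr. Qed.

Lemma tensZl m n c (p : {mpoly k[m]}) (q : {mpoly k[n]}) :
  (c *: p) ⊗ q = c *: (p ⊗ q).
Proof. by rewrite /tens comp_mpolyZ scalerAl. Qed.

Lemma tensZr m n c (p : {mpoly k[m]}) (q : {mpoly k[n]}) :
  p ⊗ (c *: q) = c *: (p ⊗ q).
Proof. by rewrite /tens comp_mpolyZ scalerAr. Qed.

Lemma tensM m n (p p' : {mpoly k[m]}) (q q' : {mpoly k[n]}) :
  (p ⊗ q) * (p' ⊗ q') = (p * p') ⊗ (q * q').
Proof. by rewrite /tens !rmorphM /= mulrACA. Qed.

Lemma tens11 m n : (1 : {mpoly k[m]}) ⊗ (1 : {mpoly k[n]}) = 1.
Proof. by rewrite /tens !comp_mpoly1 mulr1. Qed.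

Definition mnml m n (w : 'X_{1..m + n}) : 'X_{1..m} :=
  [multinom w (lshift n i) | i < m].
Definition mnmr m n (w : 'X_{1..m + n}) : 'X_{1..n} :=
  [multinom w (rshift m j) | j < n].

Lemma tensX m n (w : 'X_{1..m + n}) :
  ('X_[mnml w] : {mpoly k[m]}) ⊗ ('X_[mnmr w] : {mpoly k[n]}) = 'X_[w].
Proof.
rewrite /tens !comp_mpolyX [RHS]mpolyXE_id big_split_ord /=.
by congr (_ * _); apply: eq_bigr => i _; rewrite tnth_mktuple mnmE.
Qed.

(* Linear extension of a map given on the basis 'X_[u] ⊗ 'X_[v] of the tensor  *)
(* product.                                                                    *)
Definition tens_lift m n (V : lmodType k)
    (F : 'X_{1..m} -> 'X_{1..n} -> V) (t : {mpoly k[m + n]}) : V :=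
  \sum_(w <- msupp t) t@_w *: F (mnml w) (mnmr w).

Lemma tens_liftwE m n (V : lmodType k) (F : 'X_{1..m} -> 'X_{1..n} -> V) t d :
  (msize t <= d)%N ->
  tens_lift F t = \sum_(w : 'X_{1..(m + n)%N < d}) t@_w *: F (mnml w) (mnmr w).
Proof.
move=> le_td; rewrite /tens_lift.
pose I : subFinType _ := 'X_{1..(m + n)%N < d}.
rewrite (big_mksub I) //=; first last.
- by move=> w /msize_mdeg_lt /leq_trans; apply.
- exact: msupp_uniq.
rewrite big_rmcond //= => w /memN_msupp_eq0 ->; exact: scale0r.
Qed.

Lemma tens_lift_is_linear m n (V : lmodType k)
  (F : 'X_{1..m} -> 'X_{1..n} -> V) : linear (tens_lift F).
Proof.
move=> c s t.
pose d := maxn (msize (c *: s + t)) (maxn (msize s) (msize t)).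
rewrite !(@tens_liftwE _ _ _ F _ d) ?leq_max ?leqnn ?orbT //.
rewrite scaler_sumr -big_split /=; apply: eq_bigr => w _.
by rewrite linearP /= scalerDl scalerA.
Qed.

HB.instance Definition _ m n (V : lmodType k) F :=
  GRing.isLinear.Build k {mpoly k[m + n]} V _ (tens_lift F)
    (tens_lift_is_linear F).

Lemma tens_ext m n (V : lmodType k) (f g : {linear {mpoly k[m + n]} -> V}) :
  (forall p q, f (p ⊗ q) = g (p ⊗ q)) -> f =1 g.
Proof.
move=> fg t; rewrite [t]mpolyE !linear_sum; apply: eq_bigr => w _.
by rewrite !linearZ /= -tensX fg.
Qed.

Lemma tens_liftP m n (V : lmodType k)
    (F : {mpoly k[m]} -> {mpoly k[n]} -> V) :
    (forall q, linear (F^~ q)) -> (forall p, linear (F p)) ->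
  forall p q, tens_lift (fun u v => F 'X_[u] 'X_[v]) (p ⊗ q) = F p q.
Proof.
move=> linl linr p q.
have F0l y : F 0 y = 0.
  by have := linl y (-1) 0 0; rewrite scaler0 addr0 scaleN1r addNr.
have F0r x : F x 0 = 0.
  by have := linr x (-1) 0 0; rewrite scaler0 addr0 scaleN1r addNr.
pose X u : {mpoly k[m]} := 'X_[u]; pose Y v : {mpoly k[n]} := 'X_[v].
have FX u v : tens_lift (fun u v => F (X u) (Y v)) (X u ⊗ Y v) = F (X u) (Y v).
  pose w := [multinom match split i with inl a => u a | inr b => v b end
            | i < m + n].
  have wl : mnml w = u.
    by apply/mnmP => i; rewrite !mnmE (unsplitK (inl i)).
  have wr : mnmr w = v.
    by apply/mnmP => i; rewrite !mnmE (unsplitK (inr i)).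
  have -> : X u ⊗ Y v = 'X_[w] by rewrite -tensX wl wr.
  by rewrite /tens_lift msuppX big_seq1 mcoeffX eqxx scale1r wl wr.
elim/mpolyind: p => [|a u p _ _ IHp].
  by rewrite /tens comp_mpoly0 mul0r linear0 F0l.
rewrite tensDl tensZl linearP /= IHp (linl q); congr (_ *: _ + _).
elim/mpolyind: q {IHp} => [|b v q _ _ IHq].
  by rewrite /tens comp_mpoly0 mulr0 linear0 F0r.
by rewrite tensDr tensZr linearP /= IHq FX (linr 'X_[u]).
Qed.

(* f ⊗ g, for linear maps f and g *)
Definition tensf m n m' n' (f : {mpoly k[m]} -> {mpoly k[m']})
    (g : {mpoly k[n]} -> {mpoly k[n']}) : {mpoly k[m + n]} -> {mpoly k[m' + n']} :=
  tens_lift (fun u v => f 'X_[u] ⊗ g 'X_[v]).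

HB.instance Definition _ m n m' n' (f : {mpoly k[m]} -> {mpoly k[m']})
    (g : {mpoly k[n]} -> {mpoly k[n']}) := GRing.Linear.on (tensf f g).

Lemma tensfE m n m' n' (f : {linear {mpoly k[m]} -> {mpoly k[m']}})
    (g : {linear {mpoly k[n]} -> {mpoly k[n']}}) p q :
  tensf f g (p ⊗ q) = f p ⊗ g q.
Proof.
apply: (tens_liftP (F := fun p q => f p ⊗ g q)) => [y|x] c a b.
  by rewrite linearP tensDl tensZl.
by rewrite linearP tensDr tensZr.
Qed.

(* p ⊗ q |-> q ⊗ p. On V^(⊗n) = V^(⊗(n-1)) ⊗ V this is the cyclic permutation  *)
(* t_n.                                                                        *)
Definition tswap m n : {mpoly k[m + n]} -> {mpoly k[n + m]} :=
  tens_lift (fun u v => 'X_[v] ⊗ 'X_[u]).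

HB.instance Definition _ m n := GRing.Linear.on (@tswap m n).

Lemma tswapE m n (p : {mpoly k[m]}) (q : {mpoly k[n]}) :
  tswap (p ⊗ q) = q ⊗ p.
Proof.
apply: (tens_liftP (F := fun p q => q ⊗ p)) => [y|x] c a b.
  by rewrite tensDr tensZr.
by rewrite tensDl tensZl.
Qed.

Definition tassoc l m n : {mpoly k[l + (m + n)]} -> {mpoly k[l + m + n]} :=
  comp_mpoly [tuple 'X_(cast_ord (addnA l m n) i) | i < l + (m + n)].

HB.instance Definition _ l m n := GRing.Linear.on (@tassoc l m n).

Lemma tassocE l m n (p : {mpoly k[l]}) (q : {mpoly k[m]}) (r : {mpoly k[n]}) :
  tassoc (p ⊗ (q ⊗ r)) = p ⊗ q ⊗ r.
Proof.
have compA a b c (s : {mpoly k[a]}) (f : 'I_a -> {mpoly k[b]})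
    (g : 'I_b -> {mpoly k[c]}) :
    (s \mPo [tuple f i | i < a]) \mPo [tuple g i | i < b] =
    s \mPo [tuple f i \mPo [tuple g j | j < b] | i < a].
  elim/mpolyind: s => [|u w s _ _ IHs]; first by rewrite !comp_mpoly0.
  rewrite !comp_mpolyD IHs !comp_mpolyZ !comp_mpolyX rmorph_prod.
  congr (_ *: _ + _); apply: eq_bigr => i _.
  by rewrite rmorphXn /= !tnth_mktuple.
rewrite /tassoc /tens !rmorphM /= mulrA; congr (_ * _ * _); rewrite !compA;
  congr (_ \mPo _); apply: eq_from_tnth => i; rewrite !tnth_mktuple;
  rewrite !comp_mpolyXU -!tnth_nth !tnth_mktuple ?comp_mpolyXU -?tnth_nth
    ?tnth_mktuple; congr 'X_ _; apply: val_inj => /=; rewrite ?addnA //.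
Qed.

End Tensor.

Notation "p ⊗ q" := (tens p q) (at level 40, left associativity) : ring_scope.

Section CoPoisson.
Context {k : fieldType}.

Local Notation A := {mpoly k[2]}.
Local Notation AA := {mpoly k[2 + 2]}.

Definition varx : A := 'X_0.
Definition vary : A := 'X_1.

Definition Delta : A -> AA :=
  comp_mpoly [tuple varx ⊗ 1 + 1 ⊗ varx; vary ⊗ 1 + 1 ⊗ vary].

HB.instance Definition _ := GRing.LRMorphism.on Delta.

Lemma Delta_x : Delta varx = varx ⊗ 1 + 1 ⊗ varx.
Proof. exact: comp_mpolyXU. Qed.

Lemma Delta_y : Delta vary = vary ⊗ 1 + 1 ⊗ vary.
Proof. exact: comp_mpolyXU. Qed.

Definition t2 : AA -> AA := @tswap k 2 2.
Definition t3 : {mpoly k[2 + 2 + 2]} -> {mpoly k[2 + 2 + 2]} :=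
  fun t => tassoc (@tswap k (2 + 2) 2 t).

Lemma t2E (a b : A) : t2 (a ⊗ b) = b ⊗ a.
Proof. exact: tswapE. Qed.

Lemma t3E (a b c : A) : t3 (a ⊗ b ⊗ c) = c ⊗ a ⊗ b.
Proof. by rewrite /t3 tswapE tassocE. Qed.

Record copoisson (q : {linear A -> AA}) : Prop := CoPoisson {
  copoisson_skew : forall a, q a + t2 (q a) = 0;
  copoisson_jacobi : forall a, let j := tensf q idfun (q a) in
    j + t3 j + t3 (t3 j) = 0;
  copoisson_leibniz : forall a,
    tensf Delta idfun (q a) =
    tassoc (tensf idfun q (Delta a)) - t3 (t3 (tensf q idfun (Delta a)))
}.

Definition calI (t : AA) : Prop :=
  exists c : k, t = c *: (varx ⊗ vary - vary ⊗ varx).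

(* a |-> sum (-1)^|a_2| q(a_1) Delta(a_2), the sum being over the expansion of *)
(* Delta a on the basis of the a_1 ⊗ a_2 for monomials a_1 and a_2             *)
Definition I_of_q_fun (q : A -> AA) : A -> AA :=
  tens_lift (fun u v => (-1) ^+ mdeg v *: (q 'X_[u] * Delta 'X_[v])) \o Delta.

Definition q_of_I_fun (I : A -> AA) : A -> AA :=
  tens_lift (fun u v => I 'X_[u] * Delta 'X_[v]) \o Delta.

Definition I_of_q (q : {linear A -> AA}) : {linear A -> AA} := I_of_q_fun q.
Definition q_of_I (I : {linear A -> AA}) : {linear A -> AA} := q_of_I_fun I.

End CoPoisson.

(* Main.v *)
From HB Require Import structures.
Require Import Defs.
From mathcomp Require Import all_boot all_order all_algebra.
From mathcomp Require Import ring zify.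
From mathcomp.multinomials Require Import mpoly.
From Stdlib Require Import FunctionalExtensionality.
Import GRing.Theory.
Set Implicit Arguments.
Unset Strict Implicit.
Unset Printing Implicit Defensive.
Local Open Scope ring_scope.

(** For linear maps f, g from A to a commutative algebra B, write f * g for the
convolution a |-> \sum f(a_1) g(a_2).  Since A is cocommutative and
coassociative, convolution is commutative and associative; an algebra map g is
invertible for it, with inverse g \o S where S is the antipode, which multiplies
a monomial v by (-1)^|v|.  In these terms the two maps of the statement are
q |-> q * (Delta \o S) and I |-> I * Delta, so they are mutually inverse on all
linear maps from A to A ⊗ A.  It remains to see which conditions on
I = q * (Delta \o S) correspond to q being a co-Poisson structure.

Write e1, e2, e3 for the embeddings of A in the slots of A ⊗ A ⊗ A, and e12,
e13, e23 for those of A ⊗ A.  As Delta is fixed by t_2, the map q is skew if and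
only if I is.  For q skew, the co-Leibniz rule reads (Delta ⊗ 1) q = e1 * (e23 q) + (e13 q) * e2.
Each of its three terms is the convolution with the iterated coproduct
e1 * e2 * e3 of (Delta ⊗ 1) I, e23 I and e13 I respectively (leibniz_conv), so
the rule says that every t = I(a) satisfies (Delta ⊗ 1) t = e23 t + e13 t:
it is primitive in its first argument.  Multiplying the first two slots shows
that substituting 2x, 2y for x, y in the first slot doubles t.
In characteristic zero t is then homogeneous of degree 1 in the first slot, by
skewness also in the second one, and hence a multiple of
omega = x ⊗ y - y ⊗ x (primitive_skew_calI).  Conversely multiples of omega are
skew and primitive in their first argument.

For the co-Jacobi identity, let I = lambda(.) omega and let D2 = e1 * e2 * e3.
Writing f_x for a |-> f(x a), the rule (f * g)_x = f_x * g + f * g_x, valid since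
x is primitive, turns (q ⊗ 1) q into
  e12(omega) (y_3 (M_x + (x_1 + x_2) M) - x_3 (M_y + (y_1 + y_2) M)),
where M = lambda * lambda * D2 and M_z = lambda * lambda_z * D2 for z = x, y.
The values of M, M_x and M_y are fixed by t_3, and the cyclic sum vanishes by a
polynomial identity (cyclic_sum_eq0). *)

(** * Algebra maps on polynomials and on tensor products *)

Section TensorMaps.
Context {k : fieldType}.

Lemma mpolyX_ext n (V : lmodType k) (f g : {linear {mpoly k[n]} -> V}) :
  (forall m, f 'X_[m] = g 'X_[m]) -> f =1 g.
Proof.
move=> fg p; rewrite [p]mpolyE !linear_sum; apply: eq_bigr => m _.
by rewrite !linearZ /= fg.
Qed.

Lemma lrmorphX n (B : comAlgType k) (f : {lrmorphism {mpoly k[n]} -> B}) m :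
  f 'X_[m] = \prod_(i < n) f 'X_i ^+ m i.
Proof.
by rewrite mpolyXE_id rmorph_prod; apply: eq_bigr => i _; rewrite rmorphXn.
Qed.

Lemma lrmorph_ext n (B : comAlgType k) (f g : {lrmorphism {mpoly k[n]} -> B}) :
  (forall i, f 'X_i = g 'X_i) -> f =1 g.
Proof.
move=> fg; apply: mpolyX_ext => m /=; rewrite !lrmorphX.
by apply: eq_bigr => i _; rewrite fg.
Qed.

(** The embeddings p |-> p ⊗ 1 and q |-> 1 ⊗ q; both are algebra maps. *)
Definition tensl m n (p : {mpoly k[m]}) : {mpoly k[m + n]} :=
  p ⊗ (1 : {mpoly k[n]}).
Definition tensr m n (q : {mpoly k[n]}) : {mpoly k[m + n]} :=
  (1 : {mpoly k[m]}) ⊗ q.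

Fact tensl_is_linear m n : linear (@tensl m n).
Proof. by move=> c p q; rewrite /tensl tensDl tensZl. Qed.
Fact tensr_is_linear m n : linear (@tensr m n).
Proof. by move=> c p q; rewrite /tensr tensDr tensZr. Qed.
Fact tensl_is_monoid_morphism m n : monoid_morphism (@tensl m n).
Proof. by split=> [|p q]; rewrite /tensl ?tens11 // tensM mulr1. Qed.
Fact tensr_is_monoid_morphism m n : monoid_morphism (@tensr m n).
Proof. by split=> [|p q]; rewrite /tensr ?tens11 // tensM mulr1. Qed.

HB.instance Definition _ m n := GRing.isLinear.Build k _ _ _ (@tensl m n)
  (@tensl_is_linear m n).
HB.instance Definition _ m n := GRing.isLinear.Build k _ _ _ (@tensr m n)
  (@tensr_is_linear m n).
HB.instance Definition _ m n := GRing.isMonoidMorphism.Build _ _ (@tensl m n)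
  (@tensl_is_monoid_morphism m n).
HB.instance Definition _ m n := GRing.isMonoidMorphism.Build _ _ (@tensr m n)
  (@tensr_is_monoid_morphism m n).

Lemma tensEM m n (p : {mpoly k[m]}) (q : {mpoly k[n]}) :
  p ⊗ q = tensl n p * tensr m q.
Proof. by rewrite tensM mulr1 mul1r. Qed.

(** The linear map p ⊗ q |-> f p * g q into a commutative algebra B; it is an
algebra map when f and g are. *)
Definition tmap m n (B : comAlgType k) (f : {mpoly k[m]} -> B)
    (g : {mpoly k[n]} -> B) : {mpoly k[m + n]} -> B :=
  tens_lift (fun u v => f 'X_[u] * g 'X_[v]).

HB.instance Definition _ m n (B : comAlgType k) (f : {mpoly k[m]} -> B)
  (g : {mpoly k[n]} -> B) := GRing.Linear.on (tmap f g).

Section Tmap.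
Context (m n : nat) (B : comAlgType k).

Lemma tmapE (f : {linear {mpoly k[m]} -> B}) (g : {linear {mpoly k[n]} -> B})
  p q : tmap f g (p ⊗ q) = f p * g q.
Proof.
apply: (tens_liftP (F := fun p q => f p * g q)) => [y|x] c a b.
  by rewrite linearP mulrDl scalerAl.
by rewrite linearP mulrDr scalerAr.
Qed.

Lemma tmapX (f : {mpoly k[m]} -> B) (g : {mpoly k[n]} -> B) w :
  tmap f g 'X_[w] = f 'X_[mnml w] * g 'X_[mnmr w].
Proof. by rewrite /tmap /tens_lift msuppX big_seq1 mcoeffX eqxx scale1r. Qed.

Lemma tmap_comp (B' : comAlgType k) (phi : {lrmorphism B -> B'})
    (f : {mpoly k[m]} -> B) (g : {mpoly k[n]} -> B)
    (f' : {mpoly k[m]} -> B') (g' : {mpoly k[n]} -> B') :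
    (forall p, phi (f p) = f' p) -> (forall q, phi (g q) = g' q) ->
  forall t, phi (tmap f g t) = tmap f' g' t.
Proof.
move=> ff' gg' t; rewrite /tmap /tens_lift linear_sum; apply: eq_bigr => w _.
by rewrite linearZ /= rmorphM /= ff' gg'.
Qed.

Lemma tmapZl b (f : {mpoly k[m]} -> B) (g : {mpoly k[n]} -> B) t :
  tmap (fun p => b * f p) g t = b * tmap f g t.
Proof.
rewrite /tmap /tens_lift mulr_sumr; apply: eq_bigr => w _.
by rewrite -scalerAr mulrA.
Qed.

Lemma tmapZr b (f : {mpoly k[m]} -> B) (g : {mpoly k[n]} -> B) t :
  tmap f (fun p => b * g p) t = b * tmap f g t.
Proof.
rewrite /tmap /tens_lift mulr_sumr; apply: eq_bigr => w _.
by rewrite -scalerAr mulrCA.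
Qed.

Lemma tmapDl (f f' : {mpoly k[m]} -> B) (g : {mpoly k[n]} -> B) t :
  tmap (fun p => f p + f' p) g t = tmap f g t + tmap f' g t.
Proof.
rewrite /tmap /tens_lift -big_split; apply: eq_bigr => w _ /=.
by rewrite mulrDl scalerDr.
Qed.

Lemma tmapDr (f : {mpoly k[m]} -> B) (g g' : {mpoly k[n]} -> B) t :
  tmap f (fun p => g p + g' p) t = tmap f g t + tmap f g' t.
Proof.
rewrite /tmap /tens_lift -big_split; apply: eq_bigr => w _ /=.
by rewrite mulrDr scalerDr.
Qed.

Section Morphism.
Context (f : {lrmorphism {mpoly k[m]} -> B}) (g : {lrmorphism {mpoly k[n]} -> B}).

Fact tmap_is_monoid_morphism : monoid_morphism (tmap f g).
Proof.
split=> [|s t]; first by rewrite -tens11 tmapE !rmorph1 mulr1.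
elim/mpolyind: s => [|c w s _ _ IHs]; first by rewrite mul0r linear0 mul0r.
rewrite mulrDl !linearD mulrDl /= IHs; congr (_ + _).
rewrite -scalerAl !linearZ -scalerAl; congr (_ *: _) => /=.
elim/mpolyind: t {IHs} => [|d v t _ _ IHt]; first by rewrite mulr0 linear0 mulr0.
rewrite mulrDr !linearD mulrDr /= IHt; congr (_ + _).
rewrite -scalerAr !linearZ -scalerAr; congr (_ *: _) => /=.
rewrite -!(tensX w) -!(tensX v) tensM !tmapE !rmorphM /=.
exact: mulrACA.
Qed.

HB.instance Definition _ := GRing.isMonoidMorphism.Build _ _ (tmap f g)
  tmap_is_monoid_morphism.
End Morphism.
End Tmap.

Lemma tmap_swap m n (B : comAlgType k) (f : {linear {mpoly k[m]} -> B})
    (g : {linear {mpoly k[n]} -> B}) t :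
  tmap g f (tswap t) = tmap f g t.
Proof.
apply: (tens_ext (f := tmap g f \o @tswap k m n) (g := tmap f g)) => p q /=.
by rewrite tswapE !tmapE mulrC.
Qed.

Lemma tmap_tensl m n (B : comAlgType k) (f : {lrmorphism {mpoly k[m]} -> B})
    (g : {lrmorphism {mpoly k[n]} -> B}) p : tmap f g (tensl n p) = f p.
Proof. by rewrite /tensl tmapE rmorph1 mulr1. Qed.

Lemma tmap_tensr m n (B : comAlgType k) (f : {lrmorphism {mpoly k[m]} -> B})
    (g : {lrmorphism {mpoly k[n]} -> B}) q : tmap f g (tensr m q) = g q.
Proof. by rewrite /tensr tmapE rmorph1 mul1r. Qed.

Lemma tmap_id m n (t : {mpoly k[m + n]}) :
  tmap (@tensl m n) (@tensr m n) t = t.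
Proof.
apply: (tens_ext (f := tmap (@tensl m n) (@tensr m n)) (g := idfun)) => p q /=.
by rewrite tmapE tensEM.
Qed.

(** The precomposition p |-> f (X_i p) of f with multiplication by a variable. *)
Definition shift n (B : comAlgType k) i (f : {mpoly k[n]} -> B) p :=
  f ('X_i * p).

Fact shift_is_linear n (B : comAlgType k) i (f : {linear {mpoly k[n]} -> B}) :
  linear (shift i f).
Proof. by move=> c p q; rewrite /shift mulrDr -scalerAr linearP. Qed.

HB.instance Definition _ n (B : comAlgType k) i (f : {linear {mpoly k[n]} -> B}) :=
  GRing.isLinear.Build k _ _ _ (shift i f) (@shift_is_linear n B i f).

Lemma shift_lrmorph n (B : comAlgType k) i (f : {lrmorphism {mpoly k[n]} -> B}) :
  shift i f = fun p => f 'X_i * f p.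
Proof. by apply: functional_extensionality => p; rewrite /shift rmorphM. Qed.

Section TmapShift.
Context (m n : nat) (B : comAlgType k).
Context (f : {linear {mpoly k[m]} -> B}) (g : {linear {mpoly k[n]} -> B}).

Fact mul_linear n' p : linear (fun t : {mpoly k[n']} => p * t).
Proof. by move=> c s t; rewrite mulrDr scalerAr. Qed.

Lemma tmap_shiftl i t : tmap f g (tensl n 'X_i * t) = tmap (shift i f) g t.
Proof.
pose M := GRing.isLinear.Build k _ _ _ _ (mul_linear (tensl n ('X_i : {mpoly k[m]}))).
pose h : {linear _ -> _} := HB.pack (fun t => tensl n ('X_i : {mpoly k[m]}) * t) M.
apply: (tens_ext (f := tmap f g \o h)) => p q /=.
by rewrite tensM mul1r !tmapE.
Qed.

Lemma tmap_shiftr i t : tmap f g (tensr m 'X_i * t) = tmap f (shift i g) t.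
Proof.
pose M := GRing.isLinear.Build k _ _ _ _ (mul_linear (tensr m ('X_i : {mpoly k[n]}))).
pose h : {linear _ -> _} := HB.pack (fun t => tensr m ('X_i : {mpoly k[n]}) * t) M.
apply: (tens_ext (f := tmap f g \o h)) => p q /=.
by rewrite tensM mul1r !tmapE.
Qed.
End TmapShift.
End TensorMaps.
Arguments tensl {k m} n p.
Arguments tensr {k} m {n} q.

(** * The convolution product *)

Section Convolution.
Context {k : fieldType}.
Local Notation A := {mpoly k[2]}.

Lemma mpoly_alg_ind n (P : {mpoly k[n]} -> Prop) :
  P 1 -> (forall i p, P p -> P ('X_i * p)) ->
  (forall c p q, P p -> P q -> P (c *: p + q)) -> forall p, P p.
Proof.
move=> P1 PX PD.
have P0 : P 0 by rewrite -(addNr 1) -scaleN1r; apply: PD.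
elim/mpolyind => [//|c m p _ _]; apply: PD.
rewrite mpolyXE_id; elim: (index_enum _) => [|i r IHr]; first by rewrite big_nil.
rewrite big_cons; elim: (m i) => [|e IHe]; first by rewrite mul1r.
by rewrite exprS -mulrA; apply: PX.
Qed.

Lemma Delta_X i : Delta ('X_i : A) = tensl 2 'X_i + tensr 2 'X_i.
Proof.
case: i => [[|[|//]] lti]; rewrite /Delta comp_mpolyXU /=;
  by congr (tensl 2 'X_ _ + tensr 2 'X_ _); apply: val_inj.
Qed.

(** The convolution product a |-> \sum f(a_1) g(a_2). *)
Definition conv (B : comAlgType k) (f g : A -> B) (a : A) : B :=
  tmap f g (Delta a).

HB.instance Definition _ (B : comAlgType k) (f g : A -> B) :=
  GRing.Linear.copy (conv f g) (tmap f g \o @Delta k).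
HB.instance Definition _ (B : comAlgType k) (f g : {lrmorphism A -> B}) :=
  GRing.LRMorphism.copy (conv f g) (tmap f g \o @Delta k).

Section ConvTheory.
Context (B : comAlgType k).

Lemma convDl (f f' g : A -> B) a :
  conv (fun p => f p + f' p) g a = conv f g a + conv f' g a.
Proof. exact: tmapDl. Qed.

Lemma convDr (f g g' : A -> B) a :
  conv f (fun p => g p + g' p) a = conv f g a + conv f g' a.
Proof. exact: tmapDr. Qed.

Lemma convZl b (f g : A -> B) a : conv (fun p => b * f p) g a = b * conv f g a.
Proof. exact: tmapZl. Qed.

Lemma convZr b (f g : A -> B) a : conv f (fun p => b * g p) a = b * conv f g a.
Proof. exact: tmapZr. Qed.

Implicit Types f g h : {linear A -> B}.

Lemma conv1 f g : conv f g 1 = f 1 * g 1.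
Proof. by rewrite /conv rmorph1 -tens11 tmapE. Qed.

(** The variables are primitive, so precomposition with multiplication by a
variable is a derivation of the convolution product.  Together with conv1 this
characterises the product by recursion on monomials, which is how its algebraic
laws are proved below. *)
Lemma shift_conv i f g :
  shift i (conv f g) = fun a => conv (shift i f) g a + conv f (shift i g) a.
Proof.
apply: functional_extensionality => a.
rewrite /shift /conv rmorphM /= Delta_X mulrDl linearD -!/(shift _ _).
by congr (_ + _); [apply: tmap_shiftl|apply: tmap_shiftr].
Qed.

Lemma convX i f g a :
  conv f g ('X_i * a) = conv (shift i f) g a + conv f (shift i g) a.
Proof. by rewrite -[LHS]/(shift i (conv f g) a) shift_conv. Qed.

Lemma convC f g : conv f g = conv g f.
Proof.
apply: functional_extensionality => a; move: a f g.
apply: mpoly_alg_ind => [|i a IHa|c a b IHa IHb] f g.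
- by rewrite !conv1 mulrC.
- by rewrite !convX IHa (IHa f) addrC.
- by rewrite !linearP /= IHa IHb.
Qed.

Lemma convA f g h : conv f (conv g h) = conv (conv f g) h.
Proof.
apply: functional_extensionality => a; move: a f g h.
apply: mpoly_alg_ind => [|i a IHa|c a b IHa IHb] f g h.
- by rewrite !conv1 /= !conv1 mulrA.
- by rewrite !convX /= !shift_conv convDr convDl !IHa addrA.
- by rewrite [LHS]linearP [RHS]linearP /= IHa IHb.
Qed.

Lemma convCA f g h : conv f (conv g h) = conv g (conv f h).
Proof. by rewrite !convA (convC f). Qed.

Lemma convAC f g h : conv (conv f g) h = conv (conv f h) g.
Proof. by rewrite -!convA (convC g). Qed.

Lemma convXU (f g : {lrmorphism A -> B}) i : conv f g 'X_i = f 'X_i + g 'X_i.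
Proof. by rewrite /conv Delta_X linearD /= tmap_tensl tmap_tensr. Qed.

(** The convolution of two algebra maps is an algebra map. *)
Lemma conv_lrmorph (f g h : {lrmorphism A -> B}) :
  (forall i, h 'X_i = f 'X_i + g 'X_i) -> conv f g = h.
Proof.
move=> hX; apply: functional_extensionality; apply: lrmorph_ext => i /=.
by rewrite hX convXU.
Qed.

(** For Q = b (f * g), this computes Q_i * h, where Q_i is Q precomposed with
multiplication by X_i. *)
Lemma conv_shiftl i (f : {linear A -> B}) (g h : {lrmorphism A -> B}) b
    (Q : {linear A -> B}) a : (forall p, Q p = b * conv f g p) ->
  conv (shift i Q) h a =
  b * (conv (shift i f) (conv g h) a + g 'X_i * conv f (conv g h) a).
Proof.
move=> QE.
have -> : shift i Q = fun p => b * (conv (shift i f) g p + g 'X_i * conv f g p).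
  apply: functional_extensionality => p.
  by rewrite /shift QE convX shift_lrmorph convZr.
by rewrite convZl convDl convZl !convA.
Qed.

Lemma tmap_mul_tens_Delta i j (Q : {linear A -> B}) (h : {lrmorphism A -> B}) a :
  tmap Q h (('X_i ⊗ 'X_j) * Delta a) = h 'X_j * conv (shift i Q) h a.
Proof. by rewrite tensEM -mulrA tmap_shiftl tmap_shiftr shift_lrmorph tmapZr. Qed.
End ConvTheory.

Lemma comp_conv (B B' : comAlgType k) (phi : {lrmorphism B -> B'})
    (f g : A -> B) (f' g' : A -> B') :
    (forall a, phi (f a) = f' a) -> (forall a, phi (g a) = g' a) ->
  forall a, phi (conv f g a) = conv f' g' a.
Proof. by move=> ff' gg' a; apply: tmap_comp. Qed.

(** The algebra endomorphism X_i |-> c X_i.  It is the antipode for c = -1, and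
the unit composed with the counit for c = 0. *)
Definition scal n (c : k) : {mpoly k[n]} -> {mpoly k[n]} :=
  comp_mpoly [tuple c *: 'X_i | i < n].

HB.instance Definition _ n c := GRing.LRMorphism.on (@scal n c).

Lemma scalXU n c i : scal c 'X_i = c *: 'X_i :> {mpoly k[n]}.
Proof. by rewrite /scal comp_mpolyXU -tnth_nth tnth_mktuple. Qed.

Lemma scalX n c m : scal c 'X_[m] = c ^+ mdeg m *: 'X_[m] :> {mpoly k[n]}.
Proof.
rewrite lrmorphX [in RHS]mpolyXE_id mdegE expr_sum -scaler_prod.
by apply: eq_bigr => i _ /=; rewrite scalXU exprZn.
Qed.

Lemma scal1 n (p : {mpoly k[n]}) : scal 1 p = p.
Proof.
by apply: (mpolyX_ext (g := idfun)) => m /=; rewrite scalX expr1n scale1r.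
Qed.

Lemma conv_scal (B : comAlgType k) (f : {lrmorphism A -> B}) c d :
  conv (f \o @scal 2 c) (f \o @scal 2 d) = f \o @scal 2 (c + d).
Proof.
by apply: conv_lrmorph => i /=; rewrite !scalXU !linearZ -scalerDl.
Qed.

Lemma conv_scal0 (B : comAlgType k) (f : {linear A -> B}) (g : {lrmorphism A -> B}) :
  conv f (g \o @scal 2 0) = f.
Proof.
apply: functional_extensionality => a; move: a f.
apply: mpoly_alg_ind => [|i a IHa|c a b IHa IHb] f.
- by rewrite conv1 /= !rmorph1 mulr1.
- rewrite convX IHa shift_lrmorph /= scalXU scale0r rmorph0.
  by rewrite convZr mul0r addr0.
- by rewrite !linearP /= IHa IHb.
Qed.

Lemma convK (B : comAlgType k) (f : {linear A -> B}) (g : {lrmorphism A -> B}) :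
  conv (conv f g) (g \o @scal 2 (-1)) = f.
Proof.
have g1 : g \o @scal 2 1 = g :> (A -> B).
  by apply: functional_extensionality => a /=; rewrite scal1.
have := conv_scal g 1 (-1); rewrite subrr g1 => gSg.
by rewrite -convA gSg conv_scal0.
Qed.

Lemma convVK (B : comAlgType k) (f : {linear A -> B}) (g : {lrmorphism A -> B}) :
  conv (conv f (g \o @scal 2 (-1))) g = f.
Proof. by rewrite convAC convK. Qed.

(** Convolution with an algebra map is injective, stated for an additive
identity between three linear maps. *)
Lemma conv_addI (B : comAlgType k) (f f1 f2 : {linear A -> B})
    (g : {lrmorphism A -> B}) :
  (forall a, conv f g a = conv f1 g a + conv f2 g a) <->
  (forall a, f a = f1 a + f2 a).
Proof.
split=> H a; last first.
  by rewrite -convDl; congr (conv _ _ a); apply: functional_extensionality.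
have fE : conv f g = fun b => conv f1 g b + conv f2 g b.
  exact: functional_extensionality.
by rewrite -[LHS](equal_f (convK f g)) fE convDl !convK.
Qed.
End Convolution.
Arguments scal {k n} c p.

(** * The slots of the threefold tensor product and the co-Leibniz rule *)

Section Slots.
Context {k : fieldType}.
Local Notation A := {mpoly k[2]}.
Local Notation AA := {mpoly k[2 + 2]}.
Local Notation AAA := {mpoly k[2 + 2 + 2]}.

Lemma tswap_tmap m n : @tswap k m n = tmap (tensr n) (tensl m).
Proof.
congr tens_lift; apply: functional_extensionality => u.
by apply: functional_extensionality => v; rewrite tensEM mulrC.
Qed.

Lemma tensf_tmap m n m' n' (f : {mpoly k[m]} -> {mpoly k[m']})
    (g : {mpoly k[n]} -> {mpoly k[n']}) :
  tensf f g = tmap (tensl n' \o f) (tensr m' \o g).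
Proof.
congr tens_lift; apply: functional_extensionality => u.
by apply: functional_extensionality => v; rewrite tensEM.
Qed.

Fact tswap_is_monoid_morphism m n : monoid_morphism (@tswap k m n).
Proof. by rewrite tswap_tmap; split; [apply: rmorph1|apply: rmorphM]. Qed.

HB.instance Definition _ m n := GRing.isMonoidMorphism.Build _ _ (@tswap k m n)
  (@tswap_is_monoid_morphism m n).
HB.instance Definition _ l m n := GRing.LRMorphism.on (@tassoc k l m n).
HB.instance Definition _ := GRing.LRMorphism.on (@t2 k).
HB.instance Definition _ := GRing.LRMorphism.copy (@t3 k)
  (@tassoc k 2 2 2 \o @tswap k (2 + 2) 2).

(** The three embeddings of A in A ⊗ A ⊗ A. *)
Definition e1 : A -> AAA := tensl 2 \o tensl 2.
Definition e2 : A -> AAA := tensl 2 \o tensr 2.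
Definition e3 : A -> AAA := tensr (2 + 2).

HB.instance Definition _ := GRing.LRMorphism.on e1.
HB.instance Definition _ := GRing.LRMorphism.on e2.
HB.instance Definition _ := GRing.LRMorphism.on e3.

Lemma e123 (a b c : A) : a ⊗ b ⊗ c = e1 a * e2 b * e3 c.
Proof. by rewrite !tensM !mulr1 !mul1r. Qed.

Lemma t3_e1 a : t3 (e1 a) = e2 a. Proof. exact: t3E. Qed.
Lemma t3_e2 a : t3 (e2 a) = e3 a.
Proof. by rewrite /e2 /= /tensr t3E tens11. Qed.
Lemma t3_e3 a : t3 (e3 a) = e1 a.
Proof. by rewrite /e3 /tensr -tens11 t3E. Qed.

(* Sealed so that unification does not compare polynomial expressions by
   unfolding them; the equations proved so far suffice. *)
#[local] Opaque tens.

(** The embeddings of A ⊗ A in A ⊗ A ⊗ A, and Delta1 = Delta ⊗ 1. *)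
Definition e12 : AA -> AAA := tensl 2.
Definition e13 : AA -> AAA := tmap e1 e3.
Definition e23 : AA -> AAA := tmap e2 e3.
Definition Delta1 : AA -> AAA := tmap (tensl 2 \o @Delta k) e3.

HB.instance Definition _ := GRing.LRMorphism.on e12.
HB.instance Definition _ := GRing.LRMorphism.on e13.
HB.instance Definition _ := GRing.LRMorphism.on e23.
HB.instance Definition _ := GRing.LRMorphism.on Delta1.

Lemma e12E (p r : A) : e12 (p ⊗ r) = e1 p * e2 r.
Proof. by rewrite tensEM rmorphM. Qed.
Lemma e13E (p r : A) : e13 (p ⊗ r) = e1 p * e3 r.
Proof. exact: tmapE. Qed.
Lemma e23E (p r : A) : e23 (p ⊗ r) = e2 p * e3 r.
Proof. exact: tmapE. Qed.
Lemma Delta1E (p r : A) : Delta1 (p ⊗ r) = e12 (Delta p) * e3 r.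
Proof. exact: tmapE. Qed.

Lemma Delta_conv : @Delta k = conv (tensl 2) (tensr 2).
Proof. by apply/esym/conv_lrmorph => i /=; rewrite Delta_X. Qed.

Lemma e12_Delta (a : A) : e12 (Delta a) = conv e1 e2 a.
Proof. by rewrite Delta_conv; apply: comp_conv. Qed.

#[local] Opaque e1 e2 e3.

Lemma t2_Delta (a : A) : t2 (Delta a) = Delta a.
Proof.
by rewrite Delta_conv [in RHS]convC; apply: comp_conv => b; apply: t2E.
Qed.

(** The iterated coproduct a |-> \sum a_1 ⊗ a_2 ⊗ a_3. *)
Definition Delta2 : A -> AAA := conv (conv e1 e2) e3.
HB.instance Definition _ := GRing.LRMorphism.on Delta2.

Lemma Delta1_Delta (a : A) : Delta1 (Delta a) = Delta2 a.
Proof.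
have -> : Delta2 = conv (tensl 2 \o @Delta k) e3; last by [].
rewrite /Delta2; congr (conv _ e3).
by apply: functional_extensionality => b; apply: esym (e12_Delta b).
Qed.

Lemma t3_Delta2 (a : A) : t3 (Delta2 a) = Delta2 a.
Proof.
rewrite [in RHS](_ : Delta2 = conv (conv e2 e3) e1); last first.
  by rewrite [RHS]convC convA.
apply: comp_conv => b; last exact: t3_e3.
by apply: comp_conv => c; [apply: t3_e1|apply: t3_e2].
Qed.

#[local] Opaque t2 t3.

Lemma e12_tmap t : e12 t = tmap e1 e2 t.
Proof.
by apply: (tens_ext (f := e12) (g := tmap e1 e2)) => p r /=; rewrite tmapE e12E.
Qed.

Lemma t33_e12 t : t3 (t3 (e12 t)) = e13 (t2 t).
Proof.
rewrite e12_tmap [RHS]tmap_swap.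
apply: (tmap_comp (phi := @t3 k \o @t3 k)) => p /=.
  by rewrite t3_e1 t3_e2.
by rewrite t3_e2 t3_e3.
Qed.

Lemma tassoc_tensr t : tassoc (tensr 2 t) = e23 t.
Proof.
apply: (tens_ext (f := @tassoc k 2 2 2 \o tensr 2) (g := e23)) => p r /=.
by rewrite tassocE e23E e123 rmorph1 mul1r.
Qed.

Lemma tassoc_tensl a : tassoc (tensl (2 + 2) a) = e1 a.
Proof. by rewrite /tensl -tens11 tassocE. Qed.

Lemma tensf_Delta_idfun : tensf (@Delta k) idfun = Delta1.
Proof. by rewrite tensf_tmap. Qed.

Lemma tassoc_tensf_Delta (q : A -> AA) a :
  tassoc (tensf idfun q (Delta a)) = conv e1 (e23 \o q) a.
Proof.
rewrite tensf_tmap; apply: tmap_comp => p; first exact: tassoc_tensl.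
exact: tassoc_tensr.
Qed.

Lemma tensf_idfun_Delta (q : A -> AA) a :
  tensf q idfun (Delta a) = conv (e12 \o q) e3 a.
Proof. by rewrite tensf_tmap. Qed.

(** The skewness condition (1 + t_2) q = 0. *)
Definition skew_map (q : A -> AA) := forall a, q a + t2 (q a) = 0.

Lemma skew_t2 q a : skew_map q -> t2 (q a) = - q a.
Proof. by move=> /(_ a) /eqP; rewrite addrC addr_eq0 => /eqP. Qed.

Lemma skew_conv (q g : A -> AA) :
  skew_map q -> (forall a, t2 (g a) = g a) -> skew_map (conv q g).
Proof.
move=> skq t2g a.
rewrite (comp_conv (f' := fun a => -1 * q a) _ t2g) => [|b].
  by rewrite convZl mulN1r subrr.
by rewrite /= skew_t2 ?mulN1r.
Qed.

(** For q skew, t_3^2 (q ⊗ 1) Delta = - (e13 q) * e2, so that the co-Leibniz rule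
is an identity between convolution products. *)
Lemma leibnizE (q : {linear A -> AA}) : skew_map q ->
  (forall a, tensf (@Delta k) idfun (q a) =
     tassoc (tensf idfun q (Delta a)) - t3 (t3 (tensf q idfun (Delta a)))) <->
  (forall a, Delta1 (q a) = conv e1 (e23 \o q) a + conv (e13 \o q) e2 a).
Proof.
move=> skq.
suff t33 a : t3 (t3 (tensf q idfun (Delta a))) = - conv (e13 \o q) e2 a.
  by split=> H a; have := H a;
    rewrite tensf_Delta_idfun tassoc_tensf_Delta t33 opprK.
rewrite tensf_idfun_Delta -mulN1r -convZl.
apply: (comp_conv (phi := @t3 k \o @t3 k)) => b /=.
  by rewrite t33_e12 skew_t2 // rmorphN mulN1r.
by rewrite t3_e3 t3_e1.
Qed.

Lemma e23_Delta (a : A) : e23 (Delta a) = conv e2 e3 a. Proof. by []. Qed.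
Lemma e13_Delta (a : A) : e13 (Delta a) = conv e1 e3 a. Proof. by []. Qed.

#[local] Opaque conv tmap.

(** All three terms of the co-Leibniz rule for I * Delta are convolution
products with the iterated coproduct, which can be cancelled. *)
Lemma leibniz_conv (I : {linear A -> AA}) :
  (forall a, Delta1 (conv I (@Delta k) a) =
     conv e1 (e23 \o conv I (@Delta k)) a
     + conv (e13 \o conv I (@Delta k)) e2 a) <->
  (forall a, Delta1 (I a) = e23 (I a) + e13 (I a)).
Proof.
have D1 a : Delta1 (conv I (@Delta k) a) = conv (Delta1 \o I) Delta2 a.
  exact: (comp_conv (phi := Delta1) (fun=> erefl) Delta1_Delta).
have D23 : conv e1 (e23 \o conv I (@Delta k)) = conv (e23 \o I) Delta2.
  have e231 : conv e1 (conv e2 e3) = Delta2 by exact: convA.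
  transitivity (conv e1 (conv (e23 \o I) (conv e2 e3))).
    congr (conv e1 _); apply: functional_extensionality.
    exact: (comp_conv (phi := e23) (fun=> erefl) e23_Delta).
  by rewrite convCA e231.
have D13 : conv (e13 \o conv I (@Delta k)) e2 = conv (e13 \o I) Delta2.
  have e132 : conv (conv e1 e3) e2 = Delta2 by exact: convAC.
  transitivity (conv (conv (e13 \o I) (conv e1 e3)) e2).
    congr (conv _ e2); apply: functional_extensionality.
    exact: (comp_conv (phi := e13) (fun=> erefl) e13_Delta).
  rewrite -(convA (e13 \o I) (conv e1 e3) e2).
  exact: (f_equal (conv (e13 \o I)) e132).
have sumE a : conv e1 (e23 \o conv I (@Delta k)) a
      + conv (e13 \o conv I (@Delta k)) e2 a =
    conv (e23 \o I) Delta2 a + conv (e13 \o I) Delta2 a.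
  exact: (congr2 +%R (equal_f D23 a) (equal_f D13 a)).
apply: (iff_trans (B :=
    forall a, conv (Delta1 \o I) Delta2 a =
       conv (e23 \o I) Delta2 a + conv (e13 \o I) Delta2 a)).
  split=> H a.
    exact: etrans (esym (D1 a)) (etrans (H a) (sumE a)).
  exact: etrans (D1 a) (etrans (H a) (esym (sumE a))).
exact: conv_addI.
Qed.
End Slots.

(** * Skew elements that are primitive in their first argument *)

Section Bracket.
Context {k : fieldType}.
Local Notation A := {mpoly k[2]}.
Local Notation AA := {mpoly k[2 + 2]}.
Local Notation AAA := {mpoly k[2 + 2 + 2]}.

Lemma mcoeff_diag n (L : {linear {mpoly k[n]} -> {mpoly k[n]}}) (s : 'X_{1..n} -> k) :
  (forall w, L 'X_[w] = s w *: 'X_[w]) -> forall f w, (L f)@_w = s w * f@_w.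
Proof.
move=> LX f w; elim/mpolyind: f => [|c v f _ _ IHf].
  by rewrite linear0 mcoeff0 mulr0.
rewrite linearP /= !mcoeffD !mcoeffZ IHf LX mcoeffZ mcoeffX mulrDr.
congr (_ + _); have [->|_] := eqVneq v w; first by rewrite !mulr1 mulrC.
by rewrite !mulr0.
Qed.

(** The substitutions x, y |-> 2x, 2y in the first, resp. second, slot. *)
Definition scall : AA -> AA := tmap (tensl 2 \o scal 2) (tensr 2).
Definition scalr : AA -> AA := tmap (tensl 2) (tensr 2 \o scal 2).
HB.instance Definition _ := GRing.Linear.on scall.
HB.instance Definition _ := GRing.Linear.on scalr.

Lemma scallX w : scall 'X_[w] = 2 ^+ mdeg (mnml w) *: 'X_[w].
Proof.
by rewrite /scall tmapX /= scalX linearZ /= -scalerAl -tensEM tensX.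
Qed.

Lemma scalrX w : scalr 'X_[w] = 2 ^+ mdeg (mnmr w) *: 'X_[w].
Proof.
by rewrite /scalr tmapX /= scalX linearZ /= -scalerAr -tensEM tensX.
Qed.

Lemma expr2_eq2 (char0 : [pchar k] =i pred0) d : (2 ^+ d == 2 :> k) = (d == 1%N).
Proof.
have nat0 m : (m%:R == 0 :> k) = (m == 0%N) by move: m; apply/pcharf0P.
case: d => [|[|d]]; last 2 first.
- by rewrite expr1 !eqxx.
- rewrite -subr_eq0 -natrX -natrB; last by rewrite expnS leq_pmulr // expn_gt0.
  rewrite nat0 !expnS; lia.
rewrite expr0 -subr_eq0 -[X in X == _]opprK oppr_eq0 opprB.
by rewrite -[X in _ - X]/(1%:R) -natrB ?nat0.
Qed.

(** The algebra map a ⊗ b ⊗ c |-> a b ⊗ c. *)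
Definition mul12 : AAA -> AA := tmap (tmap (tensl 2) (tensl 2)) (tensr 2).
HB.instance Definition _ := GRing.LRMorphism.on mul12.

Lemma mul12_tensl t : mul12 (tensl 2 t) = tmap (tensl 2) (tensl 2) t.
Proof. exact: tmap_tensl. Qed.
Lemma mul12_e1 p : mul12 (e1 p) = tensl 2 p.
Proof. by rewrite [LHS]mul12_tensl tmap_tensl. Qed.
Lemma mul12_e2 p : mul12 (e2 p) = tensl 2 p.
Proof. by rewrite [LHS]mul12_tensl tmap_tensr. Qed.
Lemma mul12_e3 p : mul12 (e3 p) = tensr 2 p.
Proof. exact: tmap_tensr. Qed.

Lemma mul12_Delta1 f : mul12 (Delta1 f) = scall f.
Proof.
apply: (tmap_comp (phi := mul12)) => p; last exact: mul12_e3.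
rewrite [LHS]mul12_tensl.
have dbl i : (tensl 2 \o scal 2) ('X_i : A) = tensl 2 'X_i + tensl 2 'X_i :> AA.
  by rewrite /= scalXU linearZ /= scaler_nat mulr2n.
exact: (equal_f (conv_lrmorph dbl) p).
Qed.

Lemma mul12_e13 f : mul12 (e13 f) = f.
Proof.
rewrite -[RHS]tmap_id.
by apply: (tmap_comp (phi := mul12)) => p; [apply: mul12_e1|apply: mul12_e3].
Qed.

Lemma mul12_e23 f : mul12 (e23 f) = f.
Proof.
rewrite -[RHS]tmap_id.
by apply: (tmap_comp (phi := mul12)) => p; [apply: mul12_e2|apply: mul12_e3].
Qed.

(** Apply mul12 to both sides of the hypothesis. *)
Lemma scall_primitive f : Delta1 f = e23 f + e13 f -> scall f = f *+ 2.
Proof.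
move=> fP; rewrite -mul12_Delta1 fP linearD /= [X in X + _]mul12_e23.
by rewrite [X in _ + X]mul12_e13.
Qed.

Lemma scalr_t2 f : scalr (t2 f) = t2 (scall f).
Proof.
have -> : t2 (scall f) = tmap (tensr 2 \o scal 2) (tensl 2) f.
  by apply: (tmap_comp (phi := @t2 k)) => p; apply: t2E.
exact: tmap_swap.
Qed.

(** The generator of the line in which the maps I take their values. *)
Definition omega : AA := varx ⊗ vary - vary ⊗ varx.

Lemma calID (s t : AA) : calI s -> calI t -> calI (s + t).
Proof. by move=> [c ->] [d ->]; exists (c + d); rewrite scalerDl. Qed.

Lemma calIZ c (t : AA) : calI t -> calI (c *: t).
Proof. by move=> [d ->]; exists (c * d); rewrite scalerA. Qed.

Lemma calI_XX (i j : 'I_2) : calI ('X_i ⊗ 'X_j - 'X_j ⊗ 'X_i : AA).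
Proof.
have xE (h : (0 < 2)%N) : 'X_(Ordinal h) = varx :> A.
  by congr 'X_ _; apply: val_inj.
have yE (h : (1 < 2)%N) : 'X_(Ordinal h) = vary :> A.
  by congr 'X_ _; apply: val_inj.
case: i j => [[|[|//]] hi] [[|[|//]] hj]; rewrite ?xE ?yE.
- by exists 0; rewrite subrr scale0r.
- by exists 1; rewrite scale1r.
- by exists (-1); rewrite scaleN1r opprB.
- by exists 0; rewrite subrr scale0r.
Qed.

Lemma primitive_skew_calI (char0 : [pchar k] =i pred0) (f : AA) :
  t2 f = - f -> Delta1 f = e23 f + e13 f -> calI f.
Proof.
move=> skf /scall_primitive fl.
have fr : scalr f = f *+ 2.
  rewrite -[f in scalr f]opprK -skf linearN /= scalr_t2 fl linearMn /= skf.
  by rewrite mulNrn opprK.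
have supp w : w \in msupp f -> mdeg (mnml w) = 1%N /\ mdeg (mnmr w) = 1%N.
  rewrite mcoeff_msupp => fw0; split; apply/eqP; rewrite -(expr2_eq2 char0);
    apply/eqP/(mulIf fw0).
    by rewrite -(mcoeff_diag scallX) /= fl mcoeffMn mulr_natl.
  by rewrite -(mcoeff_diag scalrX) /= fr mcoeffMn mulr_natl.
have two0 : (2 : k) != 0 by rewrite (iffLR (GRing.pcharf0P k) char0).
(* Antisymmetrising f turns each monomial X_i ⊗ X_j of its support into
   X_i ⊗ X_j - X_j ⊗ X_i. *)
have -> : f = 2^-1 *: (f - t2 f).
  by rewrite skf opprK -mulr2n -scaler_nat scalerA mulVf ?scale1r.
apply: calIZ.
have -> : f - t2 f = \sum_(w <- msupp f) f@_w *: ('X_[w] - t2 'X_[w]).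
  rewrite [in LHS](mpolyE f) (raddf_sum (@t2 k)) -sumrB /=.
  by apply: eq_bigr => w _; rewrite scalerBr linearZ.
rewrite big_seq; apply: big_ind => [||w /supp[]].
- by exists 0; rewrite scale0r.
- exact: calID.
move=> /eqP/mdeg1P[i /eqP wl] /eqP/mdeg1P[j /eqP wr].
rewrite -tensX wl wr t2E; apply: calIZ; exact: calI_XX.
Qed.
End Bracket.

(** * The co-Jacobi identity *)

Section Jacobi.
Context {k : fieldType}.
Local Notation A := {mpoly k[2]}.
Local Notation AA := {mpoly k[2 + 2]}.
Local Notation AAA := {mpoly k[2 + 2 + 2]}.

(** The polynomial identity behind the co-Jacobi identity; phi stands for the
cyclic permutation of the slots, and m0, m1, m for the cyclically invariant
factors. *)
Lemma cyclic_sum_eq0 (R : comPzRingType) (phi : {rmorphism R -> R})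
    (x1 x2 x3 y1 y2 y3 m0 m1 m : R) :
    phi x1 = x2 -> phi x2 = x3 -> phi x3 = x1 ->
    phi y1 = y2 -> phi y2 = y3 -> phi y3 = y1 ->
    phi m0 = m0 -> phi m1 = m1 -> phi m = m ->
  let j := (x1 * y2 - y1 * x2) *
    (y3 * (m0 + (x1 + x2) * m) - x3 * (m1 + (y1 + y2) * m)) in
  j + phi j + phi (phi j) = 0.
Proof.
move=> px1 px2 px3 py1 py2 py3 pm0 pm1 pm j; rewrite /j.
rewrite !(rmorphM, rmorphB, rmorphD, px1, px2, px3, py1, py2, py3, pm0, pm1, pm).
ring.
Qed.

Lemma Delta1_XX (i j : 'I_2) :
  Delta1 ('X_i ⊗ 'X_j : AA) = e23 ('X_i ⊗ 'X_j) + e13 ('X_i ⊗ 'X_j).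
Proof.
rewrite [LHS]Delta1E e12_Delta convXU [LHS]mulrDl [LHS]addrC.
exact: (congr2 +%R (esym (e23E _ _)) (esym (e13E _ _))).
Qed.

(* A monomial at which omega has a nonzero coefficient, unless omega = 0; this
   makes the nonvanishing of omega irrelevant. *)
Let w0 : 'X_{1..2 + 2} := mlead (@omega k).

(** The linear form lambda such that I a = lambda(a) omega whenever I a is a
multiple of omega, viewed with values in the scalars of A ⊗ A ⊗ A. *)
Definition coord (I : A -> AA) (a : A) : AAA :=
  ((I a)@_w0 / omega@_w0)%:A.

Fact coord_is_linear (I : {linear A -> AA}) : linear (coord I).
Proof.
move=> c a b; rewrite /coord linearP mcoeffD mcoeffZ mulrDl -mulrA scalerDl.
by rewrite scalerA.
Qed.
HB.instance Definition _ (I : {linear A -> AA}) :=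
  GRing.isLinear.Build k _ _ _ (coord I) (coord_is_linear I).

Lemma coordE (I : A -> AA) a : calI (I a) ->
  I a = ((I a)@_w0 / omega@_w0) *: omega.
Proof.
move=> [c ->]; rewrite -/omega mcoeffZ.
have [->|om0] := eqVneq (@omega k) 0; first by rewrite !scaler0.
by rewrite mulfK // -/(mleadc omega) mleadc_eq0.
Qed.

(** A linear map T sends (I * Delta)(a) = \sum lambda(a_1) omega Delta(a_2) to
\sum lambda(a_1) T(omega Delta(a_2)). *)
Lemma lin_conv_calI (T : {linear AA -> AAA})
    (I : {linear A -> AA}) a : (forall b, calI (I b)) ->
  T (conv I (@Delta k) a) = conv (coord I) (fun v => T (omega * Delta v)) a.
Proof.
move=> calII; rewrite /conv /tmap /tens_lift linear_sum; apply: eq_bigr => w _.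
by rewrite linearZ /= {1}(coordE (calII _)) -scalerAl linearZ /= mulr_algl.
Qed.

(** With f = lambda, g = e1 * e2, h = e3, b = e12(omega) and Q = e12 q, the left-hand
side is (q ⊗ 1) q. *)
Lemma conv_bracket (B : comAlgType k) (f : {linear A -> B})
    (g h : {lrmorphism A -> B}) b (Q : {linear A -> B}) a :
    (forall p, Q p = b * conv f g p) ->
  conv f (fun v => tmap Q h (omega * Delta v)) a =
  b * (h vary * (conv f (conv (shift 0 f) (conv g h)) a
                 + g varx * conv f (conv f (conv g h)) a)
     - h varx * (conv f (conv (shift 1 f) (conv g h)) a
                 + g vary * conv f (conv f (conv g h)) a)).
Proof.
move=> QE.
pose F i v := conv (shift i f) (conv g h) v + g 'X_i * conv f (conv g h) v.
have -> : (fun v => tmap Q h (omega * Delta v)) =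
    fun v => (b * h vary) * F 0 v + (- (b * h varx)) * F 1 v.
  apply: functional_extensionality => v.
  rewrite /omega mulrBl linearB /= !tmap_mul_tens_Delta !(conv_shiftl _ _ _ QE).
  by rewrite -/(F 0 v) -/(F 1 v); ring.
rewrite convDr !convZr /F !convDr !convZr; ring.
Qed.

#[local] Opaque e1 e2 e3 e12 e13 e23 Delta1 conv tmap.

Lemma add_lin_eq (U V : lmodType k) (f g h : {linear U -> V}) c u v :
  f u = g u + h u -> f v = g v + h v ->
  f (c *: (u - v)) = g (c *: (u - v)) + h (c *: (u - v)).
Proof.
move=> fu fv; rewrite !linearZ !linearB /= fu fv -scalerDr; congr (_ *: _).
by rewrite opprD addrACA.
Qed.

Lemma Delta1_calI (t : AA) : calI t -> Delta1 t = e23 t + e13 t.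
Proof. by move=> [c ->]; apply: add_lin_eq; apply: Delta1_XX. Qed.

Lemma t2_calI (t : AA) : calI t -> t2 t = - t.
Proof. by move=> [c ->]; rewrite linearZ linearB /= !t2E -scalerN opprB. Qed.

Lemma e12_calI (I : A -> AA) a : calI (I a) ->
  e12 (I a) = e12 omega * coord I a.
Proof. by move=> /coordE IE; rewrite [in LHS]IE linearZ /= mulr_algr. Qed.

Lemma e12_conv_calI (I : {linear A -> AA}) a : (forall b, calI (I b)) ->
  e12 (conv I (@Delta k) a) = e12 omega * conv (coord I) (conv e1 e2) a.
Proof.
move=> calII; rewrite -convZl.
exact: (comp_conv (phi := e12) (fun b => e12_calI (calII b)) e12_Delta).
Qed.

Lemma t3_coord (I : A -> AA) a : t3 (coord I a) = coord I a.
Proof. by rewrite /coord linearZ rmorph1. Qed.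

Lemma e12_omega : e12 (@omega k) = e1 varx * e2 vary - e1 vary * e2 varx.
Proof. by rewrite [LHS](raddfB (@e12 k)) /= !e12E. Qed.

Lemma jacobi_calI (I : {linear A -> AA}) a : (forall b, calI (I b)) ->
  let j := tensf (conv I (@Delta k)) idfun (conv I (@Delta k) a) in
  j + t3 j + t3 (t3 j) = 0.
Proof.
move=> calII j; rewrite {}/j.
have QE p : (e12 \o conv I (@Delta k)) p =
    e12 omega * conv (coord I) (conv e1 e2) p by apply: e12_conv_calI.
have -> : tensf (conv I (@Delta k)) idfun =
    tmap (e12 \o conv I (@Delta k)) e3 by apply: tensf_tmap.
rewrite (lin_conv_calI (tmap (e12 \o conv I (@Delta k)) e3) a calII).
have gx : conv e1 e2 (@varx k) = e1 varx + e2 varx := convXU _ _ _.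
have gy : conv e1 e2 (@vary k) = e1 vary + e2 vary := convXU _ _ _.
rewrite (conv_bracket e3 a QE) /= gx gy e12_omega.
have t3M (f : A -> AAA) b : (forall c, t3 (f c) = f c) ->
    t3 (conv f Delta2 b) = conv f Delta2 b.
  by move=> ff; apply: (comp_conv (phi := @t3 k) ff t3_Delta2).
have t3f (f : A -> AAA) : (forall b, t3 (f b) = f b) ->
    t3 (conv (coord I) f a) = conv (coord I) f a.
  by move=> ff; apply: (comp_conv (phi := @t3 k) (t3_coord I) ff).
have t3L (f : A -> AAA) : (forall c, t3 (f c) = f c) ->
    t3 (conv (coord I) (conv f Delta2) a) = conv (coord I) (conv f Delta2) a.
  by move=> ff; apply: t3f => b; apply: t3M.
apply: (cyclic_sum_eq0 (phi := @t3 k)).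
- exact: t3_e1.
- exact: t3_e2.
- exact: t3_e3.
- exact: t3_e1.
- exact: t3_e2.
- exact: t3_e3.
- by apply: t3L => b; apply: t3_coord.
- by apply: t3L => b; apply: t3_coord.
- by apply: t3L => b; apply: t3_coord.
Qed.
End Jacobi.

(** * The correspondence *)

Section Correspondence.
Context {k : fieldType}.
Local Notation A := {mpoly k[2]}.
Local Notation AA := {mpoly k[2 + 2]}.

Lemma q_of_I_conv (I : {linear A -> AA}) : q_of_I I = conv I (@Delta k) :> (A -> AA).
Proof. by []. Qed.

Lemma I_of_q_conv (q : {linear A -> AA}) :
  I_of_q q = conv q (@Delta k \o scal (-1)) :> (A -> AA).
Proof.
apply: functional_extensionality => a; rewrite /conv /tmap.
congr (tens_lift _ _); apply: functional_extensionality => u.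
apply: functional_extensionality => v.
by rewrite /= scalX linearZ /= scalerAr.
Qed.

Lemma q_of_I_of_q (q : {linear A -> AA}) : q_of_I (I_of_q q) =1 q.
Proof.
move=> a; rewrite q_of_I_conv I_of_q_conv.
exact: (equal_f (convVK q (@Delta k))).
Qed.

Lemma I_of_q_of_I (I : {linear A -> AA}) : I_of_q (q_of_I I) =1 I.
Proof.
move=> a; rewrite I_of_q_conv q_of_I_conv.
exact: (equal_f (convK I (@Delta k))).
Qed.

Lemma copoisson_q_of_I (I : {linear A -> AA}) :
  (forall a, calI (I a)) -> copoisson (q_of_I I).
Proof.
move=> calII.
have skI : skew_map I by move=> a; rewrite t2_calI // subrr.
have skq : skew_map (q_of_I I) by exact: (skew_conv skI t2_Delta).
split=> //.
- move=> a; exact: (jacobi_calI a calII).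
- apply/(leibnizE skq)/(leibniz_conv I) => a; exact: Delta1_calI.
Qed.

Lemma calI_I_of_q (char0 : [pchar k] =i pred0) (q : {linear A -> AA}) :
  copoisson q -> forall a, calI (I_of_q q a).
Proof.
move=> [skq _ leib] a.
pose I : {linear A -> AA} := I_of_q q.
have skI : skew_map I.
  rewrite /I I_of_q_conv; apply: skew_conv => // b.
  exact: t2_Delta.
have qE : q = conv I (@Delta k) :> (A -> AA).
  by apply: functional_extensionality => b; rewrite -[LHS]q_of_I_of_q.
apply: primitive_skew_calI => //; first exact: skew_t2.
have/(leibnizE skq) := leib.
rewrite qE => /leibniz_conv; exact.
Qed.
End Correspondence.

Theorem proposition4p8 (k : fieldType) (char0 : [pchar k] =i pred0) :
  [/\ forall q : {linear {mpoly k[2]} -> {mpoly k[2 + 2]}},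
        copoisson q -> forall a, calI (I_of_q q a),
      forall I : {linear {mpoly k[2]} -> {mpoly k[2 + 2]}},
        (forall a, calI (I a)) -> copoisson (q_of_I I),
      forall q : {linear {mpoly k[2]} -> {mpoly k[2 + 2]}},
        copoisson q -> q_of_I (I_of_q q) =1 q
    & forall I : {linear {mpoly k[2]} -> {mpoly k[2 + 2]}},
        (forall a, calI (I a)) -> I_of_q (q_of_I I) =1 I].
Proof.
split=> [q|I|q _|I _].
- exact: calI_I_of_q.
- exact: copoisson_q_of_I.
- exact: q_of_I_of_q.
- exact: I_of_q_of_I.
Qed.
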